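(* Let $(X,d)$ be a compact metric space and let $\mathcal{F}=\{X; f_{\lambda}\mid\lambda\in\Lambda\}$ be an iterated function system of continuous maps, with $\Lambda$ finite and nonempty. Let $\{\epsilon_i\}_{i\ge1}$ be a sequence of positive numbers decreasing to $0$ and let $\{k_{\epsilon_i}\}_{i\ge 1}$ be a strictly increasing sequence of positive integers with $k_{\epsilon_1}\ge 2$. Suppose that for each positive integer $i$ there is a cover $C_i$ of $X$ with the following properties: (1) For each $i$, $C_i$ consists of $k_{\epsilon_i}$ pairwise disjoint, nonempty, clopen sets which are cyclically permuted by $\mathcal{F}_\sigma$, for every $\sigma\in\Lambda^{\mathbb{Z}_+}$. (2) $C_{i+1}$ partitions $C_i$ for all $i\ge1$ (each element of $C_i$ is a union of elements of $C_{i+1}$). (3) If $V_1\supset V_2\supset V_3\supset\cdots$ is a nested sequence with $V_i\in C_i$ for all $i$, then $\bigcap_{i=1}^\infty V_i$ consists of a single point. Then for every $\sigma=\{\lambda_1,\lambda_2,\lambda_3,\dots\}\in\Lambda^{\mathbb{Z}_+}$, $\mathcal{F}_\sigma$ is topologically conjugate to the adding machine map $g_\alpha$, where $\alpha=\left(k_{\epsilon_1},\frac{k_{\epsilon_2}}{k_{\epsilon_1}},\frac{k_{\epsilon_3}}{k_{\epsilon_2}},\dots\right)$.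
   Context: An iterated function system (IFS) $\mathcal{F}=\{X; f_{\lambda}\mid\lambda\in\Lambda\}$ is a family of continuous maps $f_\lambda:X\to X$ indexed by a finite nonempty set $\Lambda$. $\mathbb{Z}_+=\{n\in\mathbb{Z}: n\ge1\}$ and $\Lambda^{\mathbb{Z}_+}$ is the set of sequences $\sigma=\{\lambda_1,\lambda_2,\dots\}$ in $\Lambda$. For such $\sigma$ and $n\ge1$, $\mathcal{F}_{\sigma_n}=f_{\lambda_n}\circ f_{\lambda_{n-1}}\circ\cdots\circ f_{\lambda_1}$, and $\mathcal{F}_\sigma$ denotes the resulting (non-autonomous) system. A family of $k$ pairwise disjoint sets is cyclically permuted by $\mathcal{F}_\sigma$ if the sets can be enumerated as $E_0,\dots,E_{k-1}$ so that $f_{\lambda_n}(E_j)\subset E_{(j+1)\bmod k}$ for all $n\ge1$ and all $j$. Adding machine map: let $\alpha=(j_1,j_2,\dots)$ be a sequence of integers $j_i\ge 2$. Let $\Delta_\alpha$ be the set of sequences $(x_1,x_2,\dots)$ with $x_i\in\{0,\dots,j_i-1\}$, with metric $d_\alpha(x,y)=\sum_{i\ge1}\delta(x_i,y_i)/2^i$, where $\delta(a,b)=1$ if $a\ne b$ and $0$ if $a=b$. Addition on $\Delta_\alpha$ is coordinatewise modulo $j_i$ with carry to the right: $(x)+(y)=(z)$ where $t_0=0$, $z_i=(x_i+y_i+t_{i-1}) \bmod j_i$, and $t_i=1$ if $x_i+y_i+t_{i-1}\ge j_i$, $t_i=0$ otherwise. The adding machine map is $g_\alpha:\Delta_\alpha\to\Delta_\alpha$,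 $g_\alpha(x)=x+(1,0,0,\dots)$. $\mathcal{F}_\sigma$ is topologically conjugate to $g_\alpha$ if there is a homeomorphism $h:X\to\Delta_\alpha$ such that $h\circ\mathcal{F}_{\sigma_n}=g_\alpha^{\,n}\circ h$ for all $n\ge1$. Under the hypotheses, the quotients $k_{\epsilon_{i+1}}/k_{\epsilon_i}$ are integers $\ge2$. *)

(* Defs.v *)
From HB Require Import structures.
From mathcomp Require Import all_boot all_order all_algebra.
From mathcomp Require Import all_classical all_reals all_analysis.

Set Implicit Arguments.
Unset Strict Implicit.
Unset Printing Implicit Defensive.

Import Order.TTheory GRing.Theory Num.Theory.
Import numFieldNormedType.Exports.

Local Open Scope classical_set_scope.
Local Open Scope ring_scope.

(* Sequences are indexed from 0: [alpha i], [sigma i], [C i], ... stand for the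
   terms of index i + 1 of the sequences written (j_1, j_2, ...) in the
   mathematical text. *)

(* [R] is only there so that the metric d_alpha, with values in [R], can be
   attached to the type; without the alias the dependent product would carry
   another topology instance. *)
Definition Delta (R : realType) (alpha : nat -> nat) : Type :=
  forall i, 'I_(alpha i).

Section adding_machine_metric.
Context (R : realType) (alpha : nat -> nat).
Implicit Types x y z : Delta R alpha.

Definition delta_term x y : R^nat :=
  fun i => ((x i != y i)%:R : R) / 2 ^+ i.+1.

Definition delta_dist x y : R := limn (series (delta_term x y)).

Lemma delta_term_ge0 x y i : 0 <= delta_term x y i.
Proof. by rewrite /delta_term divr_ge0// ?ler0n// exprn_ge0. Qed.

Lemma delta_cvg x y : cvgn (series (delta_term x y)).
Proof.
apply: (@series_le_cvg _ _ (geometric (1 / 2) (1 / 2))).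
- by move=> n; exact: delta_term_ge0.
- by move=> n; rewrite /geometric/= mulr_ge0// exprn_ge0.
- move=> n; rewrite /delta_term /geometric/= -exprS expr_div_n expr1n.
  by rewrite ler_wpM2r ?invr_ge0 ?exprn_ge0// lern1 leq_b1.
- apply: is_cvg_geometric_series.
  by rewrite ger0_norm// ltr_pdivrMr// mul1r ltr1n.
Qed.

Lemma delta_distxx x : delta_dist x x = 0.
Proof.
rewrite /delta_dist (_ : series _ = cst 0) ?lim_cst//.
apply/funext => n; rewrite /series/= big1// => i _.
by rewrite /delta_term eqxx mul0r.
Qed.

Lemma delta_dist_positivity x y : delta_dist x y = 0 -> x = y.
Proof.
move=> xy0; apply/functional_extensionality_dep => i.
apply/eqP/negPn/negP => xyi.
have ndu : nondecreasing_seq (series (delta_term x y)).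
  by apply/nondecreasing_seqP => n; rewrite seriesSr lerDl delta_term_ge0.
have := nondecreasing_cvgn_le ndu (@delta_cvg x y) i.+1.
rewrite -/(delta_dist x y) xy0 seriesSr leNgt => /negP; apply.
rewrite ltr_wpDl//; last by rewrite /delta_term xyi mul1r invr_gt0 exprn_gt0.
by rewrite /series/= sumr_ge0// => j _; exact: delta_term_ge0.
Qed.

Lemma delta_dist_sym x y : delta_dist x y = delta_dist y x.
Proof.
rewrite /delta_dist (_ : delta_term x y = delta_term y x)//.
by apply/funext => i; rewrite /delta_term eq_sym.
Qed.

Lemma delta_dist_triangle y x z :
  delta_dist x z <= delta_dist x y + delta_dist y z.
Proof.
rewrite /delta_dist -limD; [|exact: delta_cvg..].
apply: ler_lim; [exact: delta_cvg|by apply: is_cvgD; exact: delta_cvg|].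
apply: nearW => n.
apply: (@le_trans _ _ (\sum_(0 <= i < n)
    (delta_term x y i + delta_term y z i))); last by rewrite big_split.
rewrite /series/= ler_sum// => i _.
rewrite /delta_term -mulrDl ler_wpM2r ?invr_ge0 ?exprn_ge0// -natrD ler_nat.
have [->|xyi] := eqVneq (x i) (y i); first by rewrite add0n.
by rewrite (leq_trans (leq_b1 _))// leq_addr.
Qed.

HB.instance Definition _ := gen_eqMixin (Delta R alpha).
HB.instance Definition _ := gen_choiceMixin (Delta R alpha).
HB.instance Definition _ := @isMetric.Build R (Delta R alpha) delta_dist
  delta_distxx delta_dist_positivity delta_dist_sym delta_dist_triangle.

End adding_machine_metric.

(* [carry alpha x y i] is the carry into position [i], that is t_i in the
   1-based convention t_0 = 0. *)
Fixpoint carry (alpha x y : nat -> nat) (i : nat) : nat :=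
  if i is j.+1 then (alpha j <= x j + y j + carry alpha x y j)%N else 0%N.

Definition digit_add (alpha x y : nat -> nat) (i : nat) : nat :=
  ((x i + y i + carry alpha x y i) %% alpha i)%N.

Definition one_digits (i : nat) : nat := (i == 0)%N.

Lemma digit_add_lt (R : realType) (alpha : nat -> nat) (x : Delta R alpha)
    (y : nat -> nat) (i : nat) :
  (digit_add alpha (fun j => x j) y i < alpha i)%N.
Proof. by rewrite ltn_mod (leq_ltn_trans _ (ltn_ord (x i))). Qed.

(* The summand (1, 0, 0, ...) is a sequence of naturals, so that no bound on
   [alpha] is needed; it belongs to Delta as soon as every [alpha i] is at
   least 2. *)
Definition adding_machine (R : realType) (alpha : nat -> nat)
    (x : Delta R alpha) : Delta R alpha :=
  fun i => Ordinal (digit_add_lt x one_digits i).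

Fixpoint ifs_iter (X Lambda : Type) (f : Lambda -> X -> X)
    (sigma : nat -> Lambda) (n : nat) : X -> X :=
  if n is m.+1 then f (sigma m) \o ifs_iter f sigma m else id.

Definition cyclically_permuted (X Lambda : Type) (f : Lambda -> X -> X)
    (sigma : nat -> Lambda) (k : nat) (C : set (set X)) : Prop :=
  exists E : 'I_k -> set X,
    [/\ injective E, range E = C &
        forall n j, f (sigma n) @` E j `<=` E (ordS j)].

Definition homeomorphism (X Y : topologicalType) (h : X -> Y) : Prop :=
  continuous h /\
  exists h' : Y -> X, [/\ cancel h h', cancel h' h & continuous h'].

Definition conjugate_to_adding_machine (R : realType) (X : metricType R)
    (Lambda : Type) (f : Lambda -> X -> X) (sigma : nat -> Lambda)
    (alpha : nat -> nat) : Prop :=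
  exists h : X -> Delta R alpha,
    homeomorphism h /\
    forall n, (1 <= n)%N ->
      h \o ifs_iter f sigma n = iter n (@adding_machine R alpha) \o h.

(* (k_1, k_2 / k_1, k_3 / k_2, ...); [%/] is the quotient in nat, used only
   where the division is exact. *)
Definition quotient_seq (k : nat -> nat) (i : nat) : nat :=
  if i is j.+1 then (k j.+1 %/ k j)%N else k 0%N.

(* Main.v *)
Require Import Defs.
From mathcomp Require Import all_boot all_order all_algebra.
From mathcomp Require Import all_classical all_reals all_analysis.
From mathcomp Require Import lra.

(* Label the blocks of C_i cyclically from the block of a base point x0, so that
   q_i : X -> {0, ..., k_i - 1} satisfies q_i (f x) = q_i x + 1 mod k_i and
   q_i x0 = 0.  Since q_(i+1) determines q_i and q_i takes the value n mod k_i
   at the n-th point of the orbit of x0, comparing x with the orbit point of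
   time q_(i+1) x gives q_i = q_(i+1) mod k_i, and comparing x0 with the orbit
   point of time k_(i+1) gives k_i | k_(i+1).  The conjugacy sends x to the
   mixed-radix digits of the coherent sequence (q_i x)_i: adding 1 to every
   q_i x is the addition of (1, 0, 0, ...) with carry. *)

Set Implicit Arguments.
Unset Strict Implicit.

Import Order.TTheory GRing.Theory Num.Theory.
Import numFieldNormedType.Exports.

Local Open Scope classical_set_scope.
Local Open Scope ring_scope.

(** * Topology: maps into the metric space [Delta] *)

Lemma continuous_bij_homeomorphism (X Y : topologicalType) (h : X -> Y) :
  compact [set: X] -> hausdorff_space Y -> continuous h -> bijective h ->
  homeomorphism h.
Proof.
move=> cX hY ch [h' hK h'K]; split => //; exists h'; split => //.
apply/continuous_closedP => A cA.
(* Preimages under [h'] are images under [h]. A closed [A] is compact, so its image is compact,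
   hence closed in the Hausdorff space [Y]. *)
have -> : h' @^-1` A = h @` A.
  apply/seteqP; split => [y Ay|_ [x Ax <-]]; first by exists (h' y).
  by rewrite /preimage/= hK.
apply: compact_closed => //; apply: continuous_compact.
  exact: continuous_subspaceT.
exact: subclosed_compact cA cX _.
Qed.

Lemma delta_dist_le_expr (R : realType) (alpha : nat -> nat)
    (x y : Delta R alpha) (N : nat) :
  (forall i, (i < N)%N -> x i = y i) -> delta_dist x y <= 2^-1 ^+ N.
Proof.
move=> xy; apply: limr_le; first exact: delta_cvg.
have S0 : series (delta_term x y) N = 0.
  rewrite /series/= big_nat big1// => i /andP[_ /xy xyi].
  by rewrite /delta_term xyi eqxx mul0r.
(* The added term is the whole tail of the series of the [2^-(i+1)], so the left side cannot grow
   with [m]: each new term is at most half of that tail. *)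
have SN m : series (delta_term x y) (N + m)%N + 2^-1 ^+ (N + m) <= 2^-1 ^+ N.
  elim: m => [|m]; first by rewrite addn0 S0 add0r.
  apply: le_trans; rewrite addnS seriesSr.
  rewrite -addrA lerD2l /delta_term -exprVn.
  have h2 : (2^-1 : R) ^+ (N + m) = 2^-1 ^+ (N + m).+1 + 2^-1 ^+ (N + m).+1.
    by rewrite exprS; lra.
  by rewrite h2 lerD2r ler_piMl ?exprn_ge0 ?invr_ge0// lern1 leq_b1.
exists N => // n /= Nn; rewrite -(subnKC Nn).
by apply: le_trans (SN (n - N)%N); rewrite lerDl exprn_ge0// invr_ge0.
Qed.

(** Agreement of the first [N] digits forces distance at most [2^-N], so closeness up to [e]
    involves only finitely many neighbourhoods. *)
Lemma locally_constant_continuous_Delta (R : realType) (X : topologicalType)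
    (alpha : nat -> nat) (h : X -> Delta R alpha) :
  (forall x i, \forall y \near x, h y i = h x i) -> continuous h.
Proof.
move=> hloc x; apply/cvg_ballP => e e_gt0.
have [N _ Ne] : \forall n \near \oo, 2^-1 ^+ n < e :> R.
  have h1 : `|2^-1 : R| < 1 by rewrite ger0_norm ?invr_ge0// invf_lt1// ltr1n.
  by have /cvgrPdist_lt/(_ e e_gt0) := cvg_expr h1; apply: filterS => n;
    rewrite sub0r normrN ger0_norm// exprn_ge0// invr_ge0.
have : \forall y \near x, forall i : 'I_N, h y i = h x i.
  by apply: filter_forall => i; exact: hloc.
apply: filterS => y hyx; rewrite ballEmdist /=.
apply: le_lt_trans (Ne N (leqnn N)).
by apply: delta_dist_le_expr => i iN; rewrite (hyx (Ordinal iN)).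
Qed.

(** * Arithmetic: mixed-radix expansions and the odometer carry *)

Definition mixed_digit (k q : nat -> nat) (i : nat) : nat :=
  if i is j.+1 then (q j.+1 %/ k j)%N else q 0%N.

Section mixed_radix.
Variable k : nat -> nat.
Hypothesis k_gt0 : forall i, (0 < k i)%N.
Hypothesis k_dvd : forall i, (k i %| k i.+1)%N.
Implicit Type q : nat -> nat.

Lemma mixed_digit_lt q i : (forall j, q j < k j)%N ->
  (mixed_digit k q i < quotient_seq k i)%N.
Proof. by move=> qk; case: i => //= i; rewrite ltn_divLR// divnK. Qed.

(** By Euclidean division, [q i.+1] is recovered from its quotient by [k i], which is the digit, and
    its remainder [q i]. *)
Lemma mixed_digit_inj q q' : (forall i, q i = q i.+1 %% k i)%N ->
  (forall i, q' i = q' i.+1 %% k i)%N ->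
  mixed_digit k q =1 mixed_digit k q' -> q =1 q'.
Proof.
move=> qS q'S qq'; elim=> [|i IH]; first exact: qq' 0%N.
have /= qi := qq' i.+1.
by rewrite (divn_eq (q i.+1) (k i)) (divn_eq (q' i.+1) (k i)) qi -qS -q'S IH.
Qed.

(** Inverse of [mixed_digit]: digit 0 has weight 1 and digit [j.+1] has weight [k j]. *)
Fixpoint mixed_value (d : nat -> nat) (i : nat) : nat :=
  if i is j.+1 then (d j.+1 * k j + mixed_value d j)%N else d 0%N.

Lemma mixed_value_lt d : (forall i, d i < quotient_seq k i)%N ->
  forall i, (mixed_value d i < k i)%N.
Proof.
move=> dlt; elim=> [|i IH] /=; first exact: dlt 0%N.
rewrite -(divnK (k_dvd i)).
apply: (@leq_trans ((d i.+1).+1 * k i)%N).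
  by rewrite mulSn addnC ltn_add2r.
by rewrite leq_mul2r orbC (dlt i.+1).
Qed.

Lemma mixed_valueS d : (forall i, d i < quotient_seq k i)%N ->
  forall i, mixed_value d i = (mixed_value d i.+1 %% k i)%N.
Proof. by move=> dlt i /=; rewrite modnMDl modn_small// mixed_value_lt. Qed.

Lemma mixed_valueK d : (forall i, d i < quotient_seq k i)%N ->
  mixed_digit k (mixed_value d) =1 d.
Proof.
by move=> dlt [//|i] /=; rewrite divnMDl// divn_small ?addn0// mixed_value_lt.
Qed.

Lemma mixed_succ_div i n : (n.+1 %/ k i = n %/ k i + (n %% k i).+1 %/ k i)%N.
Proof. by rewrite {1}(divn_eq n (k i)) -addnS divnMDl. Qed.

(** The carry leaves position [i] exactly when the digits up to [i] are all maximal, that is when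
    [q i] is [k i - 1]. *)
Lemma carry_mixed_digit q : (forall i, q i < k i)%N ->
  (forall i, q i = q i.+1 %% k i)%N ->
  forall i, carry (quotient_seq k) (mixed_digit k q) one_digits i.+1 =
            ((q i).+1 %/ k i)%N.
Proof.
move=> qk qS i.
have divE j : ((q j).+1 %/ k j = (k j <= (q j).+1))%N.
  have := qk j; rewrite leq_eqVlt => /predU1P[->|lt].
    by rewrite divnn k_gt0 leqnn.
  by rewrite divn_small// leqNgt lt.
elim: i => [|i IH]; first by rewrite divE /= /one_digits/= addn0 addn1.
rewrite divE -[LHS]/(nat_of_bool (k i.+1 %/ k i <=
  q i.+1 %/ k i + one_digits i.+1 +
  carry (quotient_seq k) (mixed_digit k q) one_digits i.+1)%N).
(* Digit plus incoming carry is [(q i.+1).+1 %/ k i]; as [k i] divides [k i.+1], comparing quotients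
   amounts to comparing [k i.+1] with [(q i.+1).+1]. *)
by rewrite IH addn0 (qS i) -mixed_succ_div leq_divRL// divnK.
Qed.

Lemma digit_add_mixed_digit q : (forall i, q i < k i)%N ->
  (forall i, q i = q i.+1 %% k i)%N ->
  digit_add (quotient_seq k) (mixed_digit k q) one_digits =1
  mixed_digit k (fun i => (q i).+1 %% k i)%N.
Proof.
move=> qk qS [|i]; first by rewrite /digit_add/= addn0 addn1.
rewrite /digit_add carry_mixed_digit//= addn0 (qS i) -mixed_succ_div.
by rewrite modn_divl divnK.
Qed.

End mixed_radix.

(** * Dynamics: cyclic labels of the blocks *)

Lemma cyclic_index (X Lambda : Type) (f : Lambda -> X -> X)
    (sigma : nat -> Lambda) (k : nat) (C : set (set X)) (x0 : X) :
  \bigcup_(V in C) V = [set: X] -> trivIset C id ->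
  cyclically_permuted f sigma k C ->
  exists q : X -> nat,
    [/\ q x0 = 0%N, forall x, (q x < k)%N,
        forall x, C (q @^-1` [set q x]) &
        forall n x, q (f (sigma n) x) = ((q x).+1 %% k)%N].
Proof.
move=> C_cover C_disj [E [E_inj EC fE]].
have /choice[p Ep] : forall x, exists j, E j x.
  move=> x; have : [set: X] x by [].
  by rewrite -C_cover -EC => -[_ [j _ <-]] Ejx; exists j.
have pE x j : E j x -> p x = j.
  move=> Ejx; apply/E_inj/C_disj; last by exists x.
    by rewrite -EC; exists (p x).
  by rewrite -EC; exists j.
have k_gt0 : (0 < k)%N by exact: leq_ltn_trans (ltn_ord (p x0)).
(* Rotates the enumeration so that the block of [x0] gets label 0; adding [k - p x0] subtracts
   [p x0] modulo [k]. *)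
pose q x := ((p x + (k - p x0)) %% k)%N.
have q_inj x y : q x = q y -> p x = p y.
  move=> /eqP; rewrite /q eqn_modDr !modn_small// => /eqP pxy.
  exact: val_inj.
exists q; split.
- by rewrite /q subnKC ?modnn// ltnW.
- by move=> x; rewrite ltn_mod.
- move=> x; rewrite -EC; exists (p x) => //.
  apply/seteqP; split => y /=; first by move=> /pE pyx; rewrite /q pyx.
  by move=> /q_inj <-.
- move=> n x; rewrite /q (pE _ (ordS (p x))); last by apply: fE; exists x.
  by rewrite /= modnDml addSn -[in RHS]addn1 modnDml addn1.
Qed.

Lemma cyclic_index_iter (X Lambda : Type) (f : Lambda -> X -> X)
    (sigma : nat -> Lambda) (k : nat) (q : X -> nat) (x : X) :
  q x = 0%N -> (forall n x, q (f (sigma n) x) = (q x).+1 %% k)%N ->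
  forall n, q (ifs_iter f sigma n x) = (n %% k)%N.
Proof.
move=> qx qf; elim=> [|n IH]; first by rewrite qx mod0n.
by rewrite /= qf IH -addn1 modnDml addn1.
Qed.

Lemma compatible_cyclic_index (X Lambda : Type) (f : Lambda -> X -> X)
    (sigma : nat -> Lambda) (k k' : nat) (q q' : X -> nat) (x0 : X) :
  q x0 = 0%N -> q' x0 = 0%N ->
  (forall n x, q (f (sigma n) x) = (q x).+1 %% k)%N ->
  (forall n x, q' (f (sigma n) x) = (q' x).+1 %% k')%N ->
  (forall x, q' x < k')%N ->
  (forall x y, q' x = q' y -> q x = q y) ->
  (k %| k')%N /\ forall x, q x = (q' x %% k)%N.
Proof.
move=> qx0 q'x0 qf q'f q'k' qq'.
have qn := cyclic_index_iter qx0 qf; have q'n := cyclic_index_iter q'x0 q'f.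
split=> [|x].
  rewrite /dvdn -qn -qx0; apply/eqP/qq'.
  by rewrite q'n modnn q'x0.
by rewrite -qn; apply: qq'; rewrite q'n modn_small.
Qed.

(** * The conjugacy with the adding machine *)

Unset Implicit Arguments.
Set Strict Implicit.

Theorem lemma4p5 (R : realType) (X : metricType R)
  (X_compact : compact [set: X])
  (Lambda : finType) (Lambda_nonempty : (0 < #|Lambda|)%N)
  (f : Lambda -> X -> X) (f_continuous : forall l, continuous (f l))
  (eps : nat -> R) (eps_gt0 : forall i, 0 < eps i)
  (eps_decreasing : nonincreasing_seq eps)
  (eps_cvg0 : eps i @[i --> \oo] --> (0 : R))
  (k : nat -> nat) (k_ge2 : (2 <= k 0)%N)
  (k_increasing : forall i, (k i < k i.+1)%N)
  (C : nat -> set (set X))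
  (C_cover : forall i, \bigcup_(V in C i) V = [set: X])
  (C_card : forall i, (C i #= `I_(k i))%card)
  (C_disjoint : forall i, trivIset (C i) id)
  (C_nonempty : forall i V, C i V -> V !=set0)
  (C_clopen : forall i V, C i V -> clopen V)
  (C_permuted : forall i (sigma : nat -> Lambda),
     cyclically_permuted f sigma (k i) (C i))
  (C_refine : forall i V, C i V ->
     exists2 D : set (set X), D `<=` C i.+1 & V = \bigcup_(W in D) W)
  (C_nested : forall V : nat -> set X,
     (forall i, C i (V i)) -> (forall i, V i.+1 `<=` V i) ->
     exists x : X, \bigcap_i V i = [set x]) :
  forall sigma : nat -> Lambda,
    conjugate_to_adding_machine f sigma (quotient_seq k).
Proof.
move=> sigma.
have [x0 _] : [set: X] !=set0.
  have [E [_ EC _]] := C_permuted 0%N sigma.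
  have [x _] : E (Ordinal (ltnW k_ge2)) !=set0.
    by apply: (C_nonempty 0%N); rewrite -EC; eexists.
  by exists x.
have k_gt0 i : (0 < k i)%N.
  by case: i => [|i]; [exact: ltnW|exact: leq_ltn_trans (k_increasing i)].
have /choice[q qP] := fun i =>
  cyclic_index x0 (C_cover i) (@C_disjoint i) (C_permuted i sigma).
have q0 i : q i x0 = 0%N by case: (qP i).
have qk i x : (q i x < k i)%N by case: (qP i).
have qC i x : C i (q i @^-1` [set q i x]) by case: (qP i).
have qf i n x : q i (f (sigma n) x) = ((q i x).+1 %% k i)%N by case: (qP i).
(* The block of [C i.+1] through [x] used in the refinement is a whole fibre of [q i.+1], so it also
   contains [y]. *)
have q_refine i x y : q i.+1 x = q i.+1 y -> q i x = q i y.
  move=> qxy; have [D DC VD] := C_refine _ _ (qC i x).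
  have : (q i @^-1` [set q i x]) x by [].
  rewrite VD => -[W DW Wx].
  have WE : W = q i.+1 @^-1` [set q i.+1 x].
    by apply: (C_disjoint i.+1) => //; [exact: DC|exists x].
  have : (q i @^-1` [set q i x]) y by rewrite VD; exists W => //; rewrite WE /=.
  by [].
have kq i := compatible_cyclic_index (q0 i) (q0 i.+1) (qf i) (qf i.+1)
  (qk i.+1) (@q_refine i).
have k_dvd i : (k i %| k i.+1)%N := (kq i).1.
have qS x i : q i x = (q i.+1 x %% k i)%N := (kq i).2 x.
pose h x : Delta R (quotient_seq k) := fun i =>
  Ordinal (@mixed_digit_lt k k_gt0 k_dvd (q^~ x) i (qk^~ x)).
have q_locally_constant i x : \forall y \near x, q i y = q i x.
  have [+ _] := C_clopen _ _ (qC i x).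
  by rewrite openE => /(_ x); apply.
have h_continuous : continuous h.
  apply: locally_constant_continuous_Delta => x i.
  have : \forall y \near x, mixed_digit k (q^~ y) i = mixed_digit k (q^~ x) i.
    case: i => [|i] /=; first exact: q_locally_constant.
    by apply: filterS (q_locally_constant i.+1 x) => y ->.
  by apply: filterS => y qxy; exact: val_inj.
(* The fibres over a coherent sequence are nested blocks, so the nested intersection hypothesis
   yields the point. The fibre over [n i] is a block because the orbit of [x0] visits it at time
   [n i]. *)
have q_point (n : nat -> nat) : (forall i, n i < k i)%N ->
    (forall i, n i = n i.+1 %% k i)%N ->
    exists x, [set y | forall i, q i y = n i] = [set x].
  move=> nk nS; have [] := C_nested (fun i => q i @^-1` [set n i]).
  - move=> i; suff -> : n i = q i (ifs_iter f sigma (n i) x0) by [].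
    by rewrite (cyclic_index_iter (q0 i) (qf i)) modn_small.
  - by move=> i x /= qx; rewrite qS qx.
  move=> x xE; exists x; rewrite -xE.
  by apply/seteqP; split => y /= yn i; [move=> _; exact: yn|exact: yn].
have h_bij : bijective h.
  have h_inj : injective h.
    move=> x y hxy.
    have qxy : q^~ x =1 q^~ y.
      apply: (@mixed_digit_inj k); [exact: qS|exact: qS|move=> i].
      by have := congr1 (fun d : Delta R _ => nat_of_ord (d i)) hxy.
    have [z zE] := q_point (q^~ x) (qk^~ x) (qS x).
    have : [set z] x by rewrite -zE.
    have : [set z] y by rewrite -zE /= => i; rewrite qxy.
    by move=> -> ->.
  (* Surjectivity: the values of the digit sequence [d] form a coherent sequence, and the point with
     these labels is sent to [d]. *)
  have /choice[h' h'K] : forall d, exists x, h x = d.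
    move=> d; have dlt i : (d i < quotient_seq k i)%N by exact: ltn_ord.
    have [x xE] := q_point _ (mixed_value_lt k_dvd dlt)
      (mixed_valueS k_dvd dlt).
    have qx i : q i x = mixed_value k d i.
      by have : [set x] x by []; rewrite -xE.
    exists x; apply/functional_extensionality_dep => i; apply: val_inj => /=.
    by rewrite (funext qx : q^~ x = _) mixed_valueK.
  by exists h' => // x; apply: h_inj.
exists h; split.
  by apply: continuous_bij_homeomorphism => //; exact: metric_hausdorff.
move=> n _; elim: n => [//|n IH].
(* Every map of the system adds 1 to all labels, so each one is carried by [h] to the same map
   [adding_machine]. *)
have hf x : h (f (sigma n) x) = adding_machine (h x).
  apply/functional_extensionality_dep => i; apply: val_inj => /=.
  rewrite (digit_add_mixed_digit k_gt0 k_dvd (qk^~ x) (qS x)).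
  by case: i => [|i]; rewrite /= !qf.
apply/funext => x /=; rewrite hf; congr adding_machine.
exact: (congr1 (@^~ x) IH).
Qed.
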